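(* Let $\mathbf{X}$ be a Hausdorff locally convex space and let $F\in\mathcal{F}_{\mathbf{X}}$. Let $Z$ be a linear operator in $\mathbf{X}$ with domain $\mathcal{D}(Z)\subset\mathcal{D}(F'_{ef}(0))$ and $Zg=F'_{ef}(0)g$ for all $g\in\mathcal{D}(Z)$. Let $l>0$. If there exists a local solution $f:[0,l)\to\mathbf{X}$ of the system $$f'(t)=\overline{Z}f(t),\ t\in[0,l),\qquad f(0)=h\in\mathcal{D}(\overline{Z}),$$ then $F(\tfrac{t}{n})^{n}h$ tends to $f(t)$ as $n\to\infty$ uniformly with respect to $t\in[0,t_0]$ for any $t_0\in(0,l)$.
   Context: $\mathbf{X}$ is over $\mathbb{T}\in\{\mathbb{R},\mathbb{C}\}$ with topology generated by semi-norms $\|\cdot\|_\alpha$, $\alpha\in\Omega$. $\mathcal{L}(\mathbf{X})$ is the space of bounded linear operators in $\mathbf{X}$ with the topology of pointwise convergence; $I$ is the identity; $\mathcal{D}(C)$ is the domain of $C$. A family $G_\beta\in\mathcal{L}(\mathbf{X})$, $\beta\in\Gamma$, is equicontinuous if for any $\alpha\in\Omega$ there are finitely many $\alpha_1,\dots,\alpha_n\in\Omega$ and $b_1,\dots,b_n>0$ with $\sup_\beta\|G_\beta x\|_\alpha\le\sum_i b_i\|x\|_{\alpha_i}$ for all $x\in\mathbf{X}$. For $F:[0,\infty)\to\mathcal{L}(\mathbf{X})$ and $s\ge0$ put $\mathbf{B}^F_s=\{F(\tfrac dn)^m : md/n\le s,\ n,m\in\mathbb{N},\ d\ge0\}$.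 $\mathcal{E}_{\mathbf{X}}$ is the set of $F:[0,\infty)\to\mathcal{L}(\mathbf{X})$ with $F(0)=I$ and $\mathbf{B}^F_s$ equicontinuous for every $s\ge0$. Many-valued effective derivative: $\mathcal{D}(F'_{mef}(0))$ is the set of $f\in\mathbf{X}$ for which there is a family $\{f_s\}_{s\ge0}$ in $\mathbf{X}$ such that $\lim_{h\to0}f_h=f$ and $\lim_{h\to0}h^{-1}(F(h)-F(0))f_h$ exists (limits as $h\to 0$, $h>0$); $F'_{mef}(0)f$ is the set of all $g\in\mathbf{X}$ arising as the second limit for some such family. $\mathcal{F}_{\mathbf{X}}$ is the set of $F\in\mathcal{E}_{\mathbf{X}}$ with $\mathcal{D}(F'_{mef}(0))$ dense in $\mathbf{X}$. For $F\in\mathcal{F}_{\mathbf{X}}$ each $F'_{mef}(0)f$ consists of one element, and the effective derivative $F'_{ef}(0):\mathcal{D}(F'_{mef}(0))\to\mathbf{X}$ is the linear map with $F'_{ef}(0)f\in F'_{mef}(0)f$. A linear operator is closable if the closure of its graph in $\mathbf{X}\times\mathbf{X}$ is the graph of a linear operator, its closure $\overline{Z}$; operators $Z$ as in the claim are closable. A function $g:[0,l)\to\mathbf{X}$, $l>0$, is a local solution of $f'(t)=\overline{Z}f(t)$, $t\in[0,l)$, $f(0)=h\in\mathcal{D}(\overline{Z})$, if $g(s)\in\mathcal{D}(\overline{Z})$ for all $s\in[0,l)$, $g(0)=h$, and $g'(s)=\overline{Z}g(s)$ for all $s\in[0,l)$ (derivative in the topology of $\mathbf{X}$, one-sided at $0$).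 *)

(* Defs.v *)
From HB Require Import structures.
From mathcomp Require Import all_boot all_order all_algebra.
From mathcomp Require Import all_classical all_reals all_analysis.
From mathcomp Require Import complex.

Set Implicit Arguments.
Unset Strict Implicit.
Unset Printing Implicit Defensive.

Import Order.TTheory GRing.Theory Num.Theory.
Import numFieldNormedType.Exports.

Local Open Scope classical_set_scope.
Local Open Scope ring_scope.

Variant scalar_kind := RealScalars | ComplexScalars.

Definition scalars (R : realType) (k : scalar_kind) : numFieldType :=
  match k with RealScalars => R | ComplexScalars => R[i] end.

Definition to_scalar (R : realType) (k : scalar_kind) : R -> scalars R k :=
  match k with
  | RealScalars => fun x => x
  | ComplexScalars => fun x => real_complex R x
  end.

(* A possibly unbounded, partially defined linear operator; the values of [op]
   outside [dom] are irrelevant. *)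
Record linear_operator (K : numFieldType) (X : lmodType K) := LinearOperator {
  dom : set X ;
  op :> X -> X ;
  dom0 : dom 0 ;
  dom_linear : forall (c : K) (x y : X), dom x -> dom y -> dom (c *: x + y) ;
  op_linear : forall (c : K) (x y : X), dom x -> dom y ->
    op (c *: x + y) = c *: op x + op y
}.

Section Operators.
Context {K : numFieldType} {X : tvsType K}.

Definition graph (Z : linear_operator X) : set (X * X) :=
  [set xy | dom Z xy.1 /\ xy.2 = Z xy.1].

(* The closure of Z is the operator whose graph is [closure (graph Z)]. When Z
   is closable there is exactly one y to be chosen for x in [closure_dom Z]. *)
Definition closure_dom (Z : linear_operator X) : set X :=
  [set x | exists y, closure (graph Z) (x, y)].

Definition closure_op (Z : linear_operator X) (x : X) : X :=
  xget 0 [set y | closure (graph Z) (x, y)].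

End Operators.

Section LocallyConvex.
Context {R : realType} {k : scalar_kind} {X : tvsType (scalars R k)}.
Context {Omega : Type}.
Implicit Types (p : Omega -> X -> R) (F : R -> {linear X -> X}).

Local Notation "x %:K" := (to_scalar k x).

(* Nonnegativity of q is a consequence of the two axioms. *)
Definition seminorm (q : X -> R) : Prop :=
  (forall x y : X, q (x + y) <= q x + q y) /\
  (forall (c : scalars R k) (x : X), (q (c *: x))%:K = `|c| * (q x)%:K).

Definition generating_seminorms p : Prop :=
  (forall a, seminorm (p a)) /\
  (forall (x : X) (U : set X), nbhs x U <->
     exists (n : nat) (a : 'I_n -> Omega) (e : R), 0 < e /\
       [set y | forall i, p (a i) (y - x) < e] `<=` U).

Definition seminorm_bounded p (B : set X) : Prop :=
  forall a, exists M : R, forall x, B x -> p a x <= M.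

Definition bounded_operator p (G : X -> X) : Prop :=
  forall B : set X, seminorm_bounded p B -> seminorm_bounded p (G @` B).

(* The library's [equicontinuous] refers to the uniform structure of X, which
   [tvsType] does not require to be the translation-invariant one. *)
Definition equicontinuous_operators p (A : set (X -> X)) : Prop :=
  forall a, exists (n : nat) (a' : 'I_n -> Omega) (b : 'I_n -> R),
    (forall i, 0 < b i) /\
    (forall G, A G -> forall x, p a (G x) <= \sum_(i < n) b i * p (a' i) x).

(* A function on [0, +oo) is represented by one on R whose values at negative
   arguments are never used. *)

Definition powers_upto F (s : R) : set (X -> X) :=
  [set G | exists (d : R) (n m : nat), [/\ 0 <= d, (0 < n)%N, (0 < m)%N,
     m%:R * d / n%:R <= s & G = iter m (F (d / n%:R))]].

Definition class_E p F : Prop :=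
  [/\ forall t, 0 <= t -> bounded_operator p (F t),
      forall x, F 0 x = x
    & forall s, 0 <= s -> equicontinuous_operators p (powers_upto F s)].

Definition mef_derivative F (f : X) : set X :=
  [set g | exists phi : R -> X,
     (phi h @[h --> 0^'+] --> f) /\
     ((h%:K)^-1 *: (F h (phi h) - F 0 (phi h)) @[h --> 0^'+] --> g)].

Definition mef_dom F : set X := [set f | mef_derivative F f !=set0].

Definition class_F p F : Prop := class_E p F /\ dense (mef_dom F).

Definition ef_derivative F (f : X) : X := xget 0 (mef_derivative F f).

(* Derivative relative to [0, l): two-sided if 0 < s < l, right-sided at 0. *)
Definition has_derivative_on (l : R) (g : R -> X) (s : R) (v : X) : Prop :=
  (h%:K)^-1 *: (g (s + h) - g s)
    @[h --> within [set h | 0 <= s + h < l] 0^'] --> v.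

Definition local_solution (Z : linear_operator X) (l : R) (h : X)
    (g : R -> X) : Prop :=
  [/\ forall s, 0 <= s < l -> closure_dom Z (g s),
      g 0 = h
    & forall s, 0 <= s < l -> has_derivative_on l g s (closure_op Z (g s))].

Definition uniform_cvg_on p (A : set R) (u : nat -> R -> X) (v : R -> X) :=
  forall a (e : R), 0 < e ->
    \forall n \near \oo, forall t, A t -> p a (u n t - v t) < e.

End LocallyConvex.

(* Main.v *)
(* Fix a seminorm p and a seminorm q with p (F(t)^m x) <= q x for m t <= t0.
   If (x, y) is in the closure of the graph of the effective derivative, choosing
   z close to x with (F(t) z - z) / t close to y and telescoping gives
     F(t)^n x - x = t (y + F(t) y + ... + F(t)^(n-1) y) + o(1)   as t -> 0,
   and density of the domain makes F(t)^n y - y small with n t and t.  Hence,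
   with n t close to u - r, where r and u are close to s and f(r), f(u) are
   replaced by the first-order expansion of f at s, F(t)^n f(r) - f(u) is at most
   eps (u - r) + o(1).  How close r and u must be depends on s, and f' need not
   even be integrable, but a gauge (Cousin) partition of [0, s] needs no
   uniformity: summing over it bounds F(t)^n f(0) - f(s) by eps s + o(1). *)

Require Import Defs.
From HB Require Import structures.
From mathcomp Require Import all_boot all_order all_algebra.
From mathcomp Require Import all_classical all_reals all_analysis.
From mathcomp Require Import complex ring lra.

Set Implicit Arguments.
Unset Strict Implicit.
Unset Printing Implicit Defensive.

Import Order.TTheory GRing.Theory Num.Theory.
Import numFieldNormedType.Exports.

Local Open Scope classical_set_scope.
Local Open Scope ring_scope.

(** Replaces a gauge partition: for a [Q] additive over adjacent intervals, it suffices to treat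
    short intervals around each tag [s], with [r] depending on [s]. The proof takes the supremum of
    the points reachable from [a]. *)
Lemma interval_cousin (R : realType) (a b : R) (Q : R -> R -> Prop) :
  a <= b ->
  (forall x y z, a <= x -> x <= y -> y <= z -> z <= b ->
     Q x y -> Q y z -> Q x z) ->
  (forall s, a <= s <= b -> exists2 r, 0 < r & forall x y,
     a <= x -> x <= s -> s <= y -> y <= b -> s - r < x -> y < s + r -> Q x y) ->
  Q a b.
Proof.
move=> ab Qtrans Qloc; pose S := [set x | a <= x <= b /\ Q a x].
have Sa : S a.
  have [|r r0 H] := Qloc a; first by rewrite lexx.
  by split; [rewrite lexx | apply: H => //; lra].
have bS : ubound S b by move=> x [/andP[]].
have hS : has_sup S by split; [exists a | exists b].
have as_ : a <= sup S by apply: ub_le_sup => //; exists b.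
have sb : sup S <= b by apply: ge_sup => //; exists a.
have [|r r0 H] := Qloc (sup S); first by rewrite as_.
have [x [/andP[ax xb] Qx] sx] := sup_adherent r0 hS.
have xs : x <= sup S by apply: ub_le_sup => //; [exists b | split; rewrite ?ax].
have Qab y : sup S <= y -> y <= b -> y < sup S + r -> Q a y.
  by move=> sy yb yr; apply: (Qtrans _ x) => //; [apply: le_trans sy | apply: H].
case: (ltP b (sup S + r)) => [br|rb]; first exact: Qab.
(* If [b] lay beyond the neighbourhood of the supremum, a point past the supremum would still be
   reachable. *)
have : sup S + r / 2 <= sup S.
  apply: ub_le_sup; first by exists b.
  by split; [apply/andP; split; lra | apply: Qab; lra].
by lra.
Qed.

(** * Embedding of the reals in the scalar field *)

Section Scalars.
Context {R : realType} (k : scalar_kind).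
Local Notation "x %:K" := (to_scalar k x).

Lemma to_scalarD (x y : R) : (x + y)%:K = x%:K + y%:K.
Proof. by case: k => //=; rewrite rmorphD. Qed.

Lemma to_scalarN (x : R) : (- x)%:K = - x%:K.
Proof. by case: k => //=; rewrite rmorphN. Qed.

Lemma to_scalarM (x y : R) : (x * y)%:K = x%:K * y%:K.
Proof. by case: k => //=; rewrite rmorphM. Qed.

Lemma to_scalarV (x : R) : (x^-1)%:K = x%:K^-1.
Proof. by case: k => //=; rewrite fmorphV. Qed.

Lemma to_scalar1 : (1 : R)%:K = 1.
Proof. by case: k. Qed.

Lemma to_scalar0 : (0 : R)%:K = 0.
Proof. by case: k. Qed.

Lemma to_scalar_norm (x : R) : `|x%:K| = `|x|%:K.
Proof. by case: k => //=; rewrite normc_def /= expr0n addr0 sqrtr_sqr. Qed.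

Lemma to_scalar_nat (n : nat) : (n%:R : R)%:K = n%:R.
Proof. by case: k => //=; rewrite rmorph_nat. Qed.

Lemma to_scalar_inj : injective (@to_scalar R k).
Proof. by case: k => // x y []. Qed.

End Scalars.

(** * Seminorms and real scalars *)

Section RealSeminorm.
Context {R : realType} {k : scalar_kind} {X : lmodType (scalars R k)}.
Local Notation "x %:K" := (to_scalar k x).

(** Homogeneity for real scalars covers both fields at once: the factors in the estimates are times,
    time differences and their inverses. *)
Definition real_seminorm (q : X -> R) : Prop :=
  (forall x y, q (x + y) <= q x + q y) /\
  (forall r x, q (r%:K *: x) = `|r| * q x).

Context (q : X -> R) (hq : real_seminorm q).

Lemma seminorm0 : q 0 = 0.
Proof. by rewrite -(scale0r (0 : X)) -to_scalar0 hq.2 normr0 mul0r. Qed.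

Lemma seminormN x : q (- x) = q x.
Proof.
by rewrite -scaleN1r -to_scalar1 -to_scalarN hq.2 normrN normr1 mul1r.
Qed.

Lemma seminormBC x y : q (x - y) = q (y - x).
Proof. by rewrite -opprB seminormN. Qed.

Lemma seminormB_le x y : q (x - y) <= q x + q y.
Proof. by rewrite -[in leRHS](seminormN y); apply: hq.1. Qed.

Lemma seminorm_dist_le y x z : q (x - z) <= q (x - y) + q (y - z).
Proof. by rewrite -[x - z](subrKA y) hq.1. Qed.

Lemma seminorm_ge0 x : 0 <= q x.
Proof. by have := seminormB_le x x; rewrite subrr seminorm0; lra. Qed.

Lemma seminorm_sum_le (n : nat) (u : 'I_n -> X) (c : R) :
  (forall i, q (u i) <= c) -> q (\sum_(i < n) u i) <= n%:R * c.
Proof.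
elim: n u => [|n IH] u uc.
  by rewrite big_ord0 seminorm0 mul0r.
rewrite big_ord_recr /= (le_trans (hq.1 _ _))// -natr1 mulrDl mul1r lerD//.
by apply: IH => i.
Qed.

End RealSeminorm.

(** * Iterates of a linear map *)

Section Iterates.
Context {R : realType} {k : scalar_kind} {X : lmodType (scalars R k)}.
Implicit Type T : {linear X -> X}.

Lemma iter_linearB T n x y : iter n T (x - y) = iter n T x - iter n T y.
Proof. by elim: n => //= n ->; rewrite linearB. Qed.

Lemma iter_linearZ T n c x : iter n T (c *: x) = c *: iter n T x.
Proof. by elim: n => //= n ->; rewrite linearZ. Qed.

Lemma iter_telescope T m n x :
  \sum_(j < n) iter (m + j) T (T x - x) = iter (m + n) T x - iter m T x.
Proof.
elim: n => [|n IH]; first by rewrite big_ord0 addn0 subrr.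
by rewrite big_ord_recr /= IH iter_linearB addnS iterSr addrC subrKA.
Qed.

End Iterates.

(** * Estimates for iterates of [F t], with [p] along iterates dominated by [q] *)

Section Chernoff.
Context {R : realType} {k : scalar_kind} {X : lmodType (scalars R k)}.
Context (F : R -> {linear X -> X}).
Local Notation "x %:K" := (to_scalar k x).

(* The closure of the graph of the effective derivative, as seen by the single
   seminorm q: unlike the graph itself, this relation can be tested without
   diagonal arguments, which would need X to be metrizable. *)
Definition approx_derivative (q : X -> R) (x y : X) : Prop :=
  forall e : R, 0 < e -> exists2 d : R, 0 < d & forall t : R, 0 < t < d ->
    exists2 z, q (z - x) < e & q (t^-1%:K *: (F t z - z) - y) < e.

Context (p q : X -> R) (L : R).
Context (hp : real_seminorm p) (hq : real_seminorm q) (L0 : 0 <= L).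
Context (Fpq : forall (t : R) (m : nat) x, 0 < t -> m%:R * t <= L ->
  p (iter m (F t) x) <= q x).

(** The sum is a Riemann sum for the integral of the orbit of [y]. For [z] near [x] with F(t)z - z =
    t(w + y) and [w] small, telescoping is exact up to the terms in [w]. *)
Lemma iterate_integral_approx x y (e : R) : approx_derivative q x y -> 0 < e ->
  exists2 d : R, 0 < d & forall (t : R) (m n : nat), 0 < t < d -> (m + n)%:R * t <= L ->
    p (iter (m + n) (F t) x - iter m (F t) x
       - \sum_(j < n) t%:K *: iter (m + j) (F t) y) <= e.
Proof.
(* Two boundary terms in x - z count once each, and the [n] terms in t w count n t <= L in total;
   hence 2 + L. *)
move=> xy e0; have e1 : 0 < e / (2 + L) by apply: divr_gt0 => //; have := L0; lra.
have [d d0 H] := xy _ e1; exists d => // t m n td mnL.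
have [z zx zy] := H t td; have t0 : 0 < t by lra.
have le_L i : (i <= m + n)%N -> i%:R * t <= L.
  by move=> imn; apply: le_trans mnL; apply: ler_wpM2r; rewrite ?ler_nat// ltW.
set w := _ - y in zy.
have FzE : F t z - z = t%:K *: (w + y).
  rewrite subrK scalerA -to_scalarM divff ?to_scalar1 ?scale1r//; lra.
have -> : iter (m + n) (F t) x - iter m (F t) x
       - \sum_(j < n) t%:K *: iter (m + j) (F t) y =
  (iter (m + n) (F t) (x - z) - iter m (F t) (x - z))
  + \sum_(j < n) iter (m + j) (F t) (t%:K *: w).
  have -> : \sum_(j < n) iter (m + j) (F t) (t%:K *: w) =
    iter (m + n) (F t) z - iter m (F t) z
    - \sum_(j < n) t%:K *: iter (m + j) (F t) y.
    rewrite -iter_telescope FzE -sumrB; apply: eq_bigr => j _.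
    by rewrite !iter_linearZ -scalerBr -iter_linearB addrK.
  rewrite !iter_linearB [RHS]addrA; congr (_ - _); apply/eqP.
  rewrite -subr_eq !opprB addrACA [X in _ == X]addrACA; apply/eqP.
  by congr (_ + _); rewrite addrC.
have pB i : (i <= m + n)%N -> p (iter i (F t) (x - z)) <= e / (2 + L).
  move=> imn; apply: (le_trans (Fpq _ t0 (le_L _ imn))).
  by rewrite seminormBC// ltW.
apply: (le_trans (hp.1 _ _)).
have := seminormB_le hp (iter (m + n) (F t) (x - z)) (iter m (F t) (x - z)).
have := pB _ (leqnn _); have := pB _ (leq_addr n m).
have : p (\sum_(j < n) iter (m + j) (F t) (t%:K *: w)) <=
    n%:R * (t * (e / (2 + L))).
  apply: seminorm_sum_le => // j.
  apply: (le_trans (Fpq _ t0 (le_L _ _))); first by rewrite leq_add2l ltnW.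
  by rewrite hq.2 gtr0_norm// ler_wpM2l// ltW.
have : n%:R * (t * (e / (2 + L))) <= L * (e / (2 + L)).
  by rewrite mulrA ler_wpM2r ?(ltW e1)// le_L// leq_addl.
have : 2 * (e / (2 + L)) + L * (e / (2 + L)) = e by field; have := L0; lra.
by lra.
Qed.

Context (D : X -> Prop).
Context (Dapprox : forall x, D x -> exists y, approx_derivative q x y).
Context (Ddense : forall x (e : R), 0 < e -> exists2 z, D z & q (z - x) < e).

(** For [z] in [D] the increment is at most n t q(y) plus a small error, by the integral
    approximation; density and the bound by [q] carry this over to [x], uniformly in [m]. *)
Lemma iterate_strong_continuity x (e : R) : 0 < e ->
  exists2 d : R, 0 < d & forall (t : R) (m n : nat), 0 < t < d -> (m + n)%:R * t <= L ->
    n%:R * t < d -> p (iter (m + n) (F t) x - iter m (F t) x) <= e.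
Proof.
move=> e0; have e4 : 0 < e / 4 by lra.
have [z Dz zx] := Ddense x e4; have [y zy] := Dapprox Dz.
have [d d0 H] := iterate_integral_approx zy e4.
have q0 := seminorm_ge0 hq y.
have q1 : 0 < e / 4 / (1 + q y) by apply: divr_gt0 => //; lra.
exists (Num.min d (e / 4 / (1 + q y))); first by rewrite lt_min d0.
move=> t m n; rewrite !lt_min => /andP[t0 /andP[td _]] mnL /andP[_ ntd].
have le_L i : (i <= m + n)%N -> i%:R * t <= L.
  by move=> imn; apply: le_trans mnL; apply: ler_wpM2r; rewrite ?ler_nat// ltW.
have := H t m n; rewrite t0 td => /(_ isT mnL).
set S := \sum_(j < n) _.
have pS : p S <= n%:R * (t * q y).
  apply: seminorm_sum_le => // j; rewrite hp.2 gtr0_norm// ler_pM2l//.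
  by apply: Fpq => //; apply: le_L; rewrite leq_add2l ltnW.
have nty : n%:R * (t * q y) <= e / 4.
  rewrite mulrA; apply: (@le_trans _ _ (e / 4 / (1 + q y) * q y)).
    by rewrite ler_wpM2r// ltW.
  rewrite -mulrA ger_pMr// mulrC ler_pdivrMr; lra.
have pB i : (i <= m + n)%N -> p (iter i (F t) x - iter i (F t) z) <= e / 4.
  move=> imn; rewrite -iter_linearB; apply: (le_trans (Fpq _ t0 (le_L _ imn))).
  by rewrite seminormBC// ltW.
move=> pz.
have := seminorm_dist_le hp (iter (m + n) (F t) z)
  (iter (m + n) (F t) x) (iter m (F t) x).
have := seminorm_dist_le hp (iter m (F t) z)
  (iter (m + n) (F t) z) (iter m (F t) x).
have := pB _ (leqnn _); have := pB _ (leq_addr n m).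
rewrite [p (iter m (F t) z - _)]seminormBC//.
have := hp.1 (iter (m + n) (F t) z - iter m (F t) z - S) S; rewrite subrK.
by lra.
Qed.

(** * Comparison of the iterates with a solution [f] on [0, T] *)

Context (T : R) (f f' : R -> X).
Context (f_approx : forall s : R, 0 <= s <= T -> approx_derivative q (f s) (f' s)).
Context (f_derive : forall s e : R, 0 <= s <= T -> 0 < e ->
  exists2 d : R, 0 < d & forall r : R, 0 <= r <= T -> `|r - s| < d ->
    q (f r - f s - (r - s)%:K *: f' s) <= e * `|r - s|).

(* The transition from f r to f s costs at most e per unit of time, up to an
   error vanishing with the step t.  Allowing this error makes the relation
   additive in the interval, although its rate of decay may depend on r, s. *)
Definition transition (e r s : R) : Prop :=
  forall e' : R, 0 < e' -> exists2 d : R, 0 < d & forall (t : R) (m n : nat), 0 < t < d ->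
    (m + n)%:R * t <= L -> `|n%:R * t - (s - r)| <= d ->
    p (iter (m + n) (F t) (f r) - iter m (F t) (f s)) <= e * (s - r) + e'.

(** The [n] steps are split: the first [n1], lasting about s - r, lead from f(r) to f(s), and the
    remaining [n2] lead on to f(u). *)
Lemma transition_trans e r s u : r <= s -> s <= u ->
  transition e r s -> transition e s u -> transition e r u.
Proof.
move=> rs su Hrs Hsu e' e'0; have e2 : 0 < e' / 2 by lra.
have [d1 d10 H1] := Hrs _ e2; have [d2 d20 H2] := Hsu _ e2.
(* Half, because the duration of the last [n2] steps is off by up to [d] from [n] and by up to t < d
   from rounding. *)
pose d := Num.min d1 d2 / 2.
have [dd1 dd2] : d * 2 <= d1 /\ d * 2 <= d2.
  by rewrite /d divfK//; split; rewrite ge_min lexx ?orbT.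
have d0 : 0 < d by rewrite /d divr_gt0// lt_min d10.
exists d => // t m n td mnL.
have t0 : 0 < t by lra.
rewrite ler_distlC => nt.
pose N := Num.truncn ((s - r) / t).
have /andP[N1 N2] : N%:R * t <= s - r < (N%:R + 1) * t.
  have /truncn_itv : 0 <= (s - r) / t by apply: divr_ge0; lra.
  by rewrite ler_pdivlMr// ltr_pdivrMr// -natr1.
have [n1 [n2 [nE [H3 H4]]]] : exists n1 n2, n = (n2 + n1)%N /\
    (`|n1%:R * t - (s - r)| <= d1 /\ `|n2%:R * t - (u - s)| <= d2).
  case: (leqP N n) => [Nn|nN].
    exists N, (n - N)%N; split; first by rewrite subnK.
    by rewrite natrB// mulrBl !ler_distlC; lra.
  (* Too few steps to reach [s]: this forces u - s <= d, so no step is left for the second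
     interval. *)
  exists n, 0%N; split; first by rewrite add0n.
  have : n%:R * t <= N%:R * t by rewrite ler_pM2r// ler_nat ltnW.
  by rewrite mul0r !ler_distlC; lra.
rewrite nE addnA.
have L1 : (m + n2 + n1)%:R * t <= L by rewrite -addnA -nE.
have L2 : (m + n2)%:R * t <= L.
  by apply: le_trans L1; rewrite ler_pM2r// ler_nat leq_addr.
have := H1 t (m + n2)%N n1; have := H2 t m n2.
have -> : 0 < t < d2 by lra.
have -> : 0 < t < d1 by lra.
move=> /(_ isT L2 H4) h2 /(_ isT L1 H3) h1.
have := seminorm_dist_le hp (iter (m + n2) (F t) (f s))
  (iter (m + n2 + n1) (F t) (f r)) (iter m (F t) (f u)).
by lra.
Qed.

(** Both f(r) and f(u) are expanded to first order at [s]; the iterates of f(s) then contribute n t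
    f'(s) approximately, which nearly cancels (u - r) f'(s). *)
Lemma transition_local (e s : R) : 0 < e -> 0 <= s <= T ->
  exists2 d : R, 0 < d & forall r u : R, 0 <= r -> r <= s -> s <= u -> u <= T ->
    s - d < r -> u < s + d -> transition e r u.
Proof.
move=> e0 sT; have e4 : 0 < e / 4 by lra.
have [d1 d10 Hder] := f_derive sT e4.
have [d2 d20 Hsc] := iterate_strong_continuity (f' s) e4.
(* The factor 4 gives n t <= u - r + c < 3 d < d2, within reach of strong continuity. *)
pose d := Num.min d1 (d2 / 4).
have [dd1 dd2] : d <= d1 /\ d * 4 <= d2.
  have -> : (d * 4 <= d2) = (d <= d2 / 4) by rewrite ler_pdivlMr.
  by split; rewrite ge_min lexx ?orbT.
have d0 : 0 < d by rewrite lt_min d10 divr_gt0.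
clearbody d; exists d => // r u r0 rs su uT sr us e' e'0.
have e4' : 0 < e' / 4 by lra.
have [d3 d30 Hint] := iterate_integral_approx (f_approx sT) e4'.
have q0 := seminorm_ge0 hq (f' s).
(* The tolerance [c] on n t - (u - r) costs at most c q(f'(s)) in [hG] and c e / 4 in [hS2];
   together they fit in e' / 4. *)
pose c := Num.min (Num.min d d3) (e' / 4 / (e + q (f' s))).
have c1 : 0 < e' / 4 / (e + q (f' s)) by apply: divr_gt0; lra.
have c0 : 0 < c by rewrite !lt_min d0 d30 c1.
have [[cd cd3] ce] : (c <= d /\ c <= d3) /\ c * (e + q (f' s)) <= e' / 4.
  rewrite -ler_pdivlMr; last by lra.
  by split; [split|]; rewrite !ge_min lexx ?orbT.
exists c => // t m n tc mnL ntc.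
have t0 : 0 < t by lra.
have le_L i : (i <= m + n)%N -> i%:R * t <= L.
  by move=> imn; apply: le_trans mnL; rewrite ler_pM2r// ler_nat.
have mL := le_L _ (leq_addr n m).
set g := f' s.
pose G i := iter i (F t).
have hr1 : p (G (m + n)%N (f r) - G (m + n)%N (f s) - (r - s)%:K *: G (m + n)%N g)
    <= e / 4 * (s - r).
  rewrite /G -iter_linearZ -!iter_linearB (le_trans (Fpq _ _ _))//.
  have -> : s - r = `|r - s| by rewrite distrC ger0_norm; lra.
  by apply: Hder; [lra | rewrite ltr_distlC; lra].
have hr2 : p (G m (f u) - G m (f s) - (u - s)%:K *: G m g) <= e / 4 * (u - s).
  rewrite /G -iter_linearZ -!iter_linearB (le_trans (Fpq _ _ _))//.
  have {2}-> : u - s = `|u - s| by rewrite ger0_norm; lra.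
  by apply: Hder; [lra | rewrite ltr_distlC; lra].
have td2 : 0 < t < d2 by lra.
have td3 : 0 < t < d3 by lra.
have ntd2 : n%:R * t < d2 by move: ntc; rewrite ler_distlC; lra.
have hI := Hint t m n td3 mnL; rewrite -/g -/(G _ _) -/(G _ _) in hI.
have hS1 : p ((r - s)%:K *: G (m + n)%N g - (r - s)%:K *: G m g)
    <= (s - r) * (e / 4).
  rewrite -scalerBr hp.2 distrC ger0_norm ?subr_ge0// ler_wpM2l ?subr_ge0//.
  exact: Hsc.
set S := \sum_(j < n) _ in hI.
have hS2 : p (S - (n%:R * t)%:K *: G m g) <= n%:R * (t * (e / 4)).
  have -> : (n%:R * t)%:K *: G m g = \sum_(j < n) t%:K *: G m g.
    by rewrite to_scalarM to_scalar_nat -scalerA scaler_nat sumr_const card_ord.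
  rewrite -sumrB; apply: seminorm_sum_le => // j.
  rewrite -scalerBr hp.2 gtr0_norm// ler_pM2l//.
  have jn : (m + j <= m + n)%N by rewrite leq_add2l ltnW.
  apply: Hsc => //; first exact: le_L.
  by apply: le_lt_trans ntd2; rewrite ler_pM2r// ler_nat ltnW.
have hG : p ((n%:R * t)%:K *: G m g - (u - r)%:K *: G m g) <= c * q g.
  rewrite -scalerBl -to_scalarN -to_scalarD hp.2.
  by apply: ler_pM => //; [apply: seminorm_ge0 | apply: Fpq].
(* Six errors: the expansions at [r] and [u], the Riemann sum [S], the two replacements of later
   iterates of [g] by [G m g], and the mismatch of n t with u - r. *)
have -> : G (m + n)%N (f r) - G m (f u) =
  (G (m + n)%N (f r) - G (m + n)%N (f s) - (r - s)%:K *: G (m + n)%N g)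
  - (G m (f u) - G m (f s) - (u - s)%:K *: G m g)
  + (G (m + n)%N (f s) - G m (f s) - S)
  + ((r - s)%:K *: G (m + n)%N g - (r - s)%:K *: G m g)
  + (S - (n%:R * t)%:K *: G m g)
  + ((n%:R * t)%:K *: G m g - (u - r)%:K *: G m g).
  have -> : (u - s)%:K *: G m g = (u - r)%:K *: G m g + (r - s)%:K *: G m g.
    by rewrite -scalerDl -to_scalarD addrA subrK.
  rewrite !opprD !opprK !addrA.
  rewrite [RHS](ACl (1*4*(8*2)*(11*3)*(5*9)*(6*16)*(7*12)*(13*10)*(15*14)))/=.
  by rewrite !subrr !addr0.
have nu : n%:R * t <= u - r + c by move: ntc; rewrite ler_distlC; lra.
set v1 := _ - _ - _ in hr1 *; set v2 := _ - _ - _ in hr2 *.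
set v3 := _ - _ - _ in hI *; set v4 := _ - _ in hS1 *; set v5 := _ - _ in hS2 *.
set v6 := _ - _ in hG *.
have h5 : n%:R * (t * (e / 4)) <= (u - r + c) * (e / 4).
  by rewrite mulrA ler_wpM2r// ltW.
have := hp.1 (v1 - v2 + v3 + v4 + v5) v6.
have := hp.1 (v1 - v2 + v3 + v4) v5; have := hp.1 (v1 - v2 + v3) v4.
have := hp.1 (v1 - v2) v3; have := seminormB_le hp v1 v2.
have : 0 <= e * (s - r) by apply: mulr_ge0; lra.
have : 0 <= e * (u - s) by apply: mulr_ge0; lra.
have : 0 <= c * e by apply: mulr_ge0; lra.
by lra.
Qed.

Context (TL : 0 <= T <= L).

(** Gauge induction is used twice: on [0, s] it yields the transition from 0 to each [s], with a
    threshold depending on [s]; on [0, T] it makes the threshold uniform. *)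
Theorem chernoff_uniform_on_grid (e : R) : 0 < e -> exists2 d : R, 0 < d &
  forall (t : R) (n : nat), 0 < t < d -> n%:R * t <= T ->
    p (iter n (F t) (f 0) - f (n%:R * t)) <= e.
Proof.
move=> e0; have /andP[T0 TL'] := TL.
have pq x : p x <= q x.
  by apply: (@Fpq 1 0) => //; rewrite mul0r; have := L0.
(* This rate accumulates to at most e / 4 over [0, T]. *)
pose e1 := e / 4 / (T + 1).
have e10 : 0 < e1 by apply: divr_gt0; lra.
have e1T : e1 * T <= e / 4.
  by rewrite -mulrA ger_pMr; [rewrite mulrC ler_pdivrMr; lra | lra].
have trans_to s : 0 <= s <= T -> transition e1 0 s.
  move=> /andP[s0 sT]; apply: interval_cousin => //.
    by move=> x y z _ xy yz _; apply: transition_trans.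
  move=> u /andP[u0 us]; have [|d d0 H] := @transition_local e1 u e10.
    by lra.
  exists d => // x y x0 xu uy ys; apply: H => //; lra.
(* One threshold for all grid times in [x, y]; the minimum of two thresholds makes [U] additive. *)
pose U x y := exists2 d : R, 0 < d & forall (t : R) (n : nat), 0 < t < d ->
  x <= n%:R * t <= y -> p (iter n (F t) (f 0) - f (n%:R * t)) <= e.
suff [d d0 H] : U 0 T.
  exists d => // t n td nT; apply: H => //; rewrite nT andbT.
  by apply: mulr_ge0 => //; lra.
apply: interval_cousin => //.
  move=> x y z _ _ _ _ [d1 d10 H1] [d2 d20 H2].
  exists (Num.min d1 d2) => [|t n]; first by rewrite lt_min d10.
  rewrite lt_min => /and3P[t0 td1 td2] /andP[xn nz].
  by case: (leP (n%:R * t) y) => ny; [apply: H1 | apply: H2];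
    rewrite ?t0 ?xn ?(ltW ny).
move=> s sT; have e4 : 0 < e / 4 by lra.
have [d1 d10 H1] := trans_to s sT _ e4.
have [d2 d20 H2] := f_derive sT ltr01.
have q0 := seminorm_ge0 hq (f' s).
pose d := Num.min (Num.min d1 d2) (e / 4 / (1 + q (f' s))).
have c1 : 0 < e / 4 / (1 + q (f' s)) by apply: divr_gt0; lra.
have d0 : 0 < d by rewrite lt_min lt_min d10 d20 c1.
have [[dd1 dd2] de] : (d <= d1 /\ d <= d2) /\ d * (1 + q (f' s)) <= e / 4.
  rewrite -ler_pdivlMr; last by lra.
  by split; [split|]; rewrite !ge_min lexx ?orbT.
clearbody d; exists d => // x y x0 xs sy yT sx ys; exists d => // t n td /andP[xn ny].
have h1 := H1 t 0%N n; rewrite /= add0n in h1.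
have sn : `|n%:R * t - s| <= d by rewrite ler_distlC; lra.
have td1 : 0 < t < d1 by lra.
have nL : n%:R * t <= L by lra.
(* A transition tolerates a mismatch between n t and [s], so the one to [s] serves all nearby grid
   times; moving from f(s) to f(n t) costs another e / 4. *)
have := h1 td1 nL; rewrite subr0 => /(_ (le_trans sn dd1)) {}h1.
have : q (f (n%:R * t) - f s) <= d * (1 + q (f' s)).
  rewrite -[f (n%:R * t) - f s](subrK ((n%:R * t - s)%:K *: f' s)).
  rewrite mulrDr mulr1 (le_trans (hq.1 _ _))// lerD//.
    apply: le_trans (H2 _ _ _) _; [lra | rewrite ltr_distlC; lra | by rewrite mul1r].
  by rewrite hq.2 ler_wpM2r.
have := pq (f (n%:R * t) - f s); rewrite [p (f _ - f s)]seminormBC//.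
have := seminorm_dist_le hp (f s) (iter n (F t) (f 0)) (f (n%:R * t)).
have : e1 * s <= e1 * T by rewrite ler_pM2l//; lra.
by lra.
Qed.
End Chernoff.

(** * From limits and closures in X to estimates in a continuous seminorm *)

Section LocallyConvexTheory.
Context {R : realType} {k : scalar_kind} {X : tvsType (scalars R k)}.
Local Notation "x %:K" := (to_scalar k x).

Lemma seminorm_real (q : X -> R) : seminorm q -> real_seminorm q.
Proof.
move=> [qD qZ]; split=> // r x; apply: (@to_scalar_inj R k).
by rewrite qZ to_scalar_norm to_scalarM.
Qed.

Lemma real_seminorm_sum (n : nat) (u : 'I_n -> X -> R) (b : 'I_n -> R) :
  (forall i, 0 < b i) -> (forall i, real_seminorm (u i)) ->
  real_seminorm (fun x => \sum_(i < n) b i * u i x).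
Proof.
move=> b0 hu; split=> [x y|r x].
  rewrite -big_split /=; apply: ler_sum => i _.
  by rewrite -mulrDr ler_pM2l// (hu i).1.
by rewrite mulr_sumr; apply: eq_bigr => i _; rewrite (hu i).2 mulrCA.
Qed.

Definition continuous_seminorm (q : X -> R) : Prop :=
  forall x (e : R), 0 < e -> nbhs x [set y | q (y - x) < e].

Lemma continuous_seminorm_sum (Omega : Type) (p : Omega -> X -> R)
    (n : nat) (a : 'I_n -> Omega) (b : 'I_n -> R) :
  generating_seminorms p -> (forall i, 0 < b i) ->
  continuous_seminorm (fun x => \sum_(i < n) b i * p (a i) x).
Proof.
move=> [hp pnbhs] b0 x e e0; apply/pnbhs.
have sb : 0 <= \sum_(i < n) b i by apply: sumr_ge0 => i _; apply: ltW.
exists n, a, (e / (1 + \sum_(i < n) b i)); split.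
  by apply: divr_gt0 => //; lra.
move=> y /= ye.
apply: (@le_lt_trans _ _ (\sum_(i < n) b i * (e / (1 + \sum_(i < n) b i)))).
  by apply: ler_sum => i _; rewrite ler_pM2l// ltW.
rewrite -mulr_suml mulrCA gtr_pMr// ltr_pdivrMr; lra.
Qed.

Context (F : R -> {linear X -> X}) (q : X -> R).
Context (F0 : forall x, F 0 x = x).
Context (hq : real_seminorm q) (cq : continuous_seminorm q).

Lemma mef_derivative_approx x y :
  mef_derivative F x y -> approx_derivative F q x y.
Proof.
move=> [phi [phix phiy]] e e0.
have [d1 /= d10 H1] := phix _ (cq x e0).
have [d2 /= d20 H2] := phiy _ (cq y e0).
exists (Num.min d1 d2); first by rewrite lt_min d10.
move=> t /andP[t0]; rewrite lt_min => /andP[td1 td2]; exists (phi t).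
  by apply: H1 => //=; rewrite sub0r normrN gtr0_norm.
have := H2 t; rewrite /= sub0r normrN gtr0_norm// F0 to_scalarV.
exact.
Qed.

(** A single graph point within e / 2 in both coordinates suffices, since only [q] is tested. *)
Lemma closure_graph_approx (Z : linear_operator X) x y :
  (forall z, dom Z z -> mef_derivative F z (Z z)) ->
  closure (graph Z) (x, y) -> approx_derivative F q x y.
Proof.
move=> ZF xy e e0; have e2 : 0 < e / 2 by lra.
have [|[x' y'] [[/= Zx ->]] [/= x'x y'y]] :=
  xy ([set u | q (u - x) < e / 2] `*` [set v | q (v - y) < e / 2]).
  by exists ([set u | q (u - x) < e / 2], [set v | q (v - y) < e / 2]) => //;
    split; apply: cq.
have [d d0 H] := mef_derivative_approx (ZF _ Zx) e2.
exists d => // t /H[z zx' zy']; exists z.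
  by have := seminorm_dist_le hq x' z x; move: x'x; lra.
apply: le_lt_trans (seminorm_dist_le hq (Z x') _ _) _; lra.
Qed.

Lemma has_derivative_on_approx (l s : R) (f : R -> X) (v : X) :
  has_derivative_on l f s v -> forall e : R, 0 < e ->
  exists2 d : R, 0 < d & forall r : R, 0 <= r < l -> `|r - s| < d ->
    q (f r - f s - (r - s)%:K *: v) <= e * `|r - s|.
Proof.
move=> fs e e0; have [d /= d0 H] := fs _ (cq v e0).
exists d => // r rl rs; have [->|rs0] := eqVneq r s.
  by rewrite !subrr to_scalar0 scale0r subrr seminorm0// normr0 mulr0.
have rs1 : r - s != 0 by rewrite subr_eq0.
have := H (r - s); rewrite /= sub0r normrN [s + _]addrC subrK => /(_ rs rs1 rl).
set w := _ - v => qw.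
have -> : f r - f s - (r - s)%:K *: v = (r - s)%:K *: w.
  rewrite scalerBr scalerA -to_scalarV -to_scalarM divff// to_scalar1.
  by rewrite scale1r.
by rewrite hq.2 mulrC ler_wpM2r// ltW.
Qed.

End LocallyConvexTheory.

(** * Uniform convergence, one generating seminorm at a time *)

Theorem theorem5p1 (R : realType) (k : scalar_kind)
    (X : tvsType (scalars R k)) (hX : hausdorff_space X)
    (Omega : Type) (p : Omega -> X -> R) (hp : generating_seminorms p)
    (F : R -> {linear X -> X}) (hF : class_F p F)
    (Z : linear_operator X) (hZdom : dom Z `<=` mef_dom F)
    (hZ : forall g : X, dom Z g -> Z g = ef_derivative F g)
    (l : R) (hl : 0 < l)
    (h : X) (hh : closure_dom Z h)
    (f : R -> X) (hf : local_solution Z l h f)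
    (t0 : R) (ht0 : 0 < t0 < l) :
  uniform_cvg_on p `[0, t0]
    (fun (n : nat) (t : R) => iter n (F (t / n%:R)) h) f.
Proof.
move: hF hf => [[_ F0 Fequi] Fdense] [fdom f0 fder] a e e0.
have /andP[t00 t0l] := ht0.
have [n [a' [b [b0 pb]]]] := Fequi t0 (ltW t00) a.
pose q x := \sum_(i < n) b i * p (a' i) x.
have hpa : real_seminorm (p a) by apply: seminorm_real; apply: hp.1.
have hq : real_seminorm q.
  by apply: real_seminorm_sum => // i; apply: seminorm_real; apply: hp.1.
have cq : continuous_seminorm q by apply: continuous_seminorm_sum.
have Fpq (t : R) (m : nat) x : 0 < t -> m%:R * t <= t0 ->
    p a (iter m (F t) x) <= q x.
  move=> t_gt0; case: m => [_|m mt].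
    (* [powers_upto] demands a positive exponent, so the identity enters as F(0) to the first
       power. *)
    rewrite -[iter 0 (F t) x]F0; apply: (pb (F 0)).
    exists 0, 1%N, 1%N; split=> //; first by rewrite mulr0 mul0r ltW.
    by rewrite mul0r.
  apply: (pb (iter m.+1 (F t))); exists t, 1%N, m.+1; split => //.
  - exact: ltW.
  - by rewrite divr1.
  - by rewrite divr1.
have ZF z : dom Z z -> mef_derivative F z (Z z).
  move=> Zz; rewrite hZ//; have [y Fy] := hZdom _ Zz.
  by rewrite /ef_derivative; apply: xgetI Fy.
have Dapprox x : mef_dom F x -> exists y, approx_derivative F q x y.
  by move=> [y xy]; exists y; apply: mef_derivative_approx.
have Ddense x (c : R) : 0 < c -> exists2 z, mef_dom F z & q (z - x) < c.
  move=> c0; have := cq x c c0; rewrite nbhsE => -[V [oV Vx] Vq].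
  have [|z [Vz Fz]] := Fdense V _ oV; first by exists x.
  by exists z => //; apply: Vq.
have fapprox s : 0 <= s <= t0 ->
    approx_derivative F q (f s) (closure_op Z (f s)).
  move=> st; apply: (closure_graph_approx F0 hq cq ZF).
  have [|y fy] := fdom s; first by lra.
  exact: (xgetI 0 (P := [set y | closure (graph Z) (f s, y)]) fy).
have fderive (s c : R) : 0 <= s <= t0 -> 0 < c ->
    exists2 d : R, 0 < d & forall r : R, 0 <= r <= t0 -> `|r - s| < d ->
    q (f r - f s - to_scalar k (r - s) *: closure_op Z (f s)) <= c * `|r - s|.
  move=> st c0; have [|d d0 H] := has_derivative_on_approx hq cq (fder s _) c0.
    by lra.
  by exists d => // r rt; apply: H; lra.
have e2 : 0 < e / 2 by lra.
have t0t0 : 0 <= t0 <= t0 by rewrite (ltW t00) lexx.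
have [d d0 H] := chernoff_uniform_on_grid hpa hq (ltW t00) Fpq Dapprox Ddense
  fapprox fderive t0t0 e2.
(* From this index on, t / N < d for every t <= t0. *)
exists (Num.truncn (t0 / d)).+1 => // N /= tN t.
rewrite /= in_itv /= => /andP[t_ge0 tt0].
have N0 : 0 < N%:R :> R by rewrite ltr0n (leq_trans _ tN).
have t0N : t0 < N%:R * d.
  rewrite -ltr_pdivrMr//; apply: lt_le_trans (truncnS_gt _) _.
  by rewrite ler_nat.
(* The grid estimate needs a positive step; at t = 0 the iterates fix [h]. *)
have [->|tn0] := eqVneq t 0.
  have -> : iter N (F (0 / N%:R)) h = h.
    by rewrite mul0r; elim: (N) => //= m ->.
  by rewrite f0 subrr seminorm0.
have tpos : 0 < t by rewrite lt_neqAle eq_sym tn0.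
have NE : N%:R * (t / N%:R) = t by rewrite mulrC divfK// gt_eqF.
have := H (t / N%:R) N; rewrite NE f0 => /(_ _ tt0) Hle.
apply: le_lt_trans (Hle _) _; last by lra.
rewrite divr_gt0//= ltr_pdivrMr// [d * _]mulrC; lra.
Qed.
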